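(* Let $(X,d)$ be a metric space and $(\phi_n)$ a sequence of functions $\phi_n:X\times X\to\mathbb{R}_+$ such that $\psi\preceq^A\phi_n$ for all $n$ for some $A:\mathbb{R}^*_+\to\mathbb{R}^*_+$, where $\psi:X\times X\to\mathbb{R}_+$ is uniformly weakly triangular with a modulus $\theta$. Further assume that $\phi_n\nearrow\phi$ uniformly with a rate $\pi$ for a function $\phi:X\times X\to\mathbb{R}_+$ which is uniformly consistent with moduli $\lambda,\Lambda:\mathbb{R}^*_+\to\mathbb{R}^*_+$. Let $F:X\to\overline{\mathbb{R}}$ be given with $\mathrm{zer}F\neq\emptyset$. Let $f:\mathbb{N}\to\mathbb{N}$ be nondecreasing with $f(n)\leq n$ and let $\kappa$ be a rate of divergence for $f$. Assume that $(x_n)\subseteq X$ is partially $(\phi_n)$-$(G,H)$-quasi-Fej\'er monotone w.r.t. $\mathrm{zer}F$, $f$ and $(\varepsilon_n)$. Let $\alpha_G$ be a $G$-modulus for $G$ and $\beta_H$ an $H$-modulus for $H$. Suppose there is $\tau:\mathbb{R}^*_+\times\mathbb{N}\to\mathbb{N}$ such that $$\forall\delta>0\ \forall n\in\mathbb{N}\ \exists N\in[n;\tau(\delta,n)]\ \big(|F(x_{2f(N)})|<\delta\big).$$ Let $\rho$ be a modulus of regularity for $F$ w.r.t. $\mathrm{zer}F$ and $S$, where $(x_n)\subseteq S\subseteq X$, and let $\xi$ be a Cauchy rate for $\sum\varepsilon_n<\infty$. Put $\rho'(\varepsilon)=\rho(\Lambda(\varepsilon/2))$ and $\beta(\delta)=\frac{\beta_H(A(\theta(\delta)))}{2}$.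 Then $(x_n)$ is $\psi$-Cauchy and $$\forall\delta>0\ \forall n,m\geq2\mu'(\delta)\ \big(\psi(x_n,x_m)<\delta\big)$$ with $$\mu'(\delta)=\tau\Big(\rho'\big(\alpha_G(\beta(\delta))/2\big),\ \max\big\{\kappa(\xi(\beta(\delta))),\ \kappa\big(\pi\big(\alpha_G(\beta(\delta))/2\big)\big)\big\}\Big).$$ If $\psi$ is even uniformly triangular with a modulus $\theta$, then $(x_n)$ is Cauchy with the same rate (with $d$ in place of $\psi$). If $\phi_n=\phi$ and $\varepsilon_n=0$ for all $n$, then the assumption that $f(n)\to\infty$ for $n\to\infty$ (i.e. the existence of $\kappa$) can be omitted and one may assume that $\tau:\mathbb{R}^*_+\to\mathbb{N}$ is such that $$\forall\delta>0\ \exists N\leq\tau(\delta)\ \big(|F(x_{2f(N)})|<\delta\big),$$ to derive that $(x_n)$ is $\psi$-Cauchy or Cauchy (depending on whether $\psi$ is uniformly weakly triangular or uniformly triangular with modulus $\theta$) with the rate $2\mu'(\delta)$, where $\mu'(\delta)=\tau\big(\rho'\big(\alpha_G(\beta(\delta))/2\big)\big)$ and the other constants are as before.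
   Context: $\mathbb{N}=\{0,1,2,\dots\}$, $\mathbb{R}_+=[0,\infty)$, $\mathbb{R}^*_+=(0,\infty)$, $\overline{\mathbb{R}}$ the extended reals, $[a;b]=\{a,\dots,b\}\subseteq\mathbb{N}$, $\mathrm{zer}F=\{x\in X\mid F(x)=0\}$. $G,H:\mathbb{R}_+\to\mathbb{R}_+$ and $(\varepsilon_n)\subseteq\mathbb{R}_+$ with $\sum\varepsilon_n<\infty$. - $\psi\preceq^A\phi$: $\phi(x,y)\leq A(\varepsilon)\to\psi(x,y)\leq\varepsilon$ for all $\varepsilon>0$, $x,y\in X$. - $\psi$ is uniformly weakly triangular with modulus $\theta:\mathbb{R}^*_+\to\mathbb{R}^*_+$: $\psi(y,x),\psi(y,z)\leq\theta(\varepsilon)\to\psi(x,z)\leq\varepsilon$ for all $\varepsilon>0$, $x,y,z\in X$; uniformly triangular with modulus $\theta$: under the same premise $d(x,z)\leq\varepsilon$. - $\phi_n\nearrow\phi$ uniformly with rate $\pi:\mathbb{R}^*_+\to\mathbb{N}$: $\phi_n(x,y)\leq\phi(x,y)+\varepsilon$ for all $\varepsilon>0$, $n\geq\pi(\varepsilon)$, $x,y\in X$. - $\phi$ is uniformly consistent with moduli $\lambda,\Lambda$: $\phi(x,y)\leq\lambda(\varepsilon)\to d(x,y)\leq\varepsilon$ and $d(x,y)\leq\Lambda(\varepsilon)\to\phi(x,y)\leq\varepsilon$ for all $\varepsilon>0$, $x,y\in X$. - $G$- and $H$-moduli $\alpha_G,\beta_H:\mathbb{R}^*_+\to\mathbb{R}^*_+$: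 $a\leq\alpha_G(\varepsilon)\to G(a)\leq\varepsilon$ and $H(a)\leq\beta_H(\varepsilon)\to a\leq\varepsilon$ for all $\varepsilon>0$, $a\in\mathbb{R}_+$. - Rate of divergence $\kappa:\mathbb{N}\to\mathbb{N}$ for $f$: $f(n)\geq L$ for all $L\in\mathbb{N}$ and $n\geq\kappa(L)$. - Cauchy rate $\xi:\mathbb{R}^*_+\to\mathbb{N}$: $\sum_{i=\xi(\varepsilon)}^\infty\varepsilon_i\leq\varepsilon$ for all $\varepsilon>0$. - $(x_n)$ is partially $(\phi_n)$-$(G,H)$-quasi-Fej\'er monotone w.r.t. $\mathrm{zer}F$, $f$ and $(\varepsilon_n)$: for all $n,m\in\mathbb{N}$ and $p\in\mathrm{zer}F$: $H(\phi_{2(n+m)}(p,x_{2(n+m)}))\leq G(\phi_{2n}(p,x_{2n}))+\sum_{i=n}^{n+m-1}\varepsilon_i$ and $H(\phi_{2(n+m)+1}(p,x_{2(n+m)+1}))\leq G(\phi_{2f(n)}(p,x_{2f(n)}))+\sum_{i=f(n)}^{n+m}\varepsilon_i$. - $\rho:\mathbb{R}^*_+\to\mathbb{R}^*_+$ is a modulus of regularity for $F$ w.r.t. $\mathrm{zer}F$ and $S$: for all $\varepsilon>0$, $x\in S$: $|F(x)|<\rho(\varepsilon)\to\mathrm{dist}(x,\mathrm{zer}F)<\varepsilon$, with $\mathrm{dist}(x,\mathrm{zer}F)=\inf_{y\in\mathrm{zer}F}d(x,y)$. - $\psi$-Cauchy: for every $\varepsilon>0$ there is $N$ with $\psi(x_n,x_m)\leq\varepsilon$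 for all $n,m\geq N$. ``$\psi$-Cauchy (Cauchy) with rate $R$'': $\psi(x_n,x_m)<\delta$ (resp. $d(x_n,x_m)<\delta$) for all $\delta>0$ and $n,m\geq R(\delta)$.
   Formalization: The rate bounds are proved with ''≤ δ'' in place of ''< δ'', for ψ and for d and in both parts, since the strict bound fails for the stated rate (e.g. ψ = min(1,d) with A(1), θ(1) large gives μ'(1) = 0 but ψ(x_0,x_1) = 1). *)

(* Defs.v *)
From HB Require Import structures.
From mathcomp Require Export all_boot all_order all_algebra.
From mathcomp Require Export all_classical all_reals all_analysis.

Set Implicit Arguments.
Unset Strict Implicit.
Unset Printing Implicit Defensive.

Import Order.TTheory GRing.Theory Num.Theory.
Import numFieldNormedType.Exports.

Local Open Scope classical_set_scope.
Local Open Scope ring_scope.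

(* A map from [0, +oo[ (resp. ]0, +oo[) to itself is encoded as a function
   R -> R satisfying [nonneg_map] (resp. [pos_map]): its values outside that
   domain are unconstrained and never used. *)

Definition nonneg_map {R : realType} (G : R -> R) :=
  forall a, 0 <= a -> 0 <= G a.

Definition pos_map {R : realType} (A : R -> R) :=
  forall e, 0 < e -> 0 < A e.

Definition nonneg_fun2 {R : realType} {X : Type} (psi : X -> X -> R) :=
  forall x y, 0 <= psi x y.

(* psi \preceq^A phi *)
Definition dominated_by {R : realType} {X : Type}
    (A : R -> R) (psi phi : X -> X -> R) :=
  forall e x y, 0 < e -> phi x y <= A e -> psi x y <= e.

Definition uniformly_weakly_triangular {R : realType} {X : Type}
    (psi : X -> X -> R) (theta : R -> R) :=
  forall e x y z, 0 < e ->
    psi y x <= theta e -> psi y z <= theta e -> psi x z <= e.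

Definition uniformly_triangular {R : realType} {X : metricType R}
    (psi : X -> X -> R) (theta : R -> R) :=
  forall e x y z, 0 < e ->
    psi y x <= theta e -> psi y z <= theta e -> mdist x z <= e.

(* phi_n \nearrow phi: the bound is one-sided and the sequence need not be
   monotone. *)
Definition increases_uniformly_to {R : realType} {X : Type}
    (phi_ : nat -> X -> X -> R) (phi : X -> X -> R) (rate : R -> nat) :=
  forall e n x y, 0 < e -> (rate e <= n)%N -> phi_ n x y <= phi x y + e.

Definition uniformly_consistent {R : realType} {X : metricType R}
    (phi : X -> X -> R) (lambda Lambda : R -> R) :=
  (forall e x y, 0 < e -> phi x y <= lambda e -> mdist x y <= e) /\
  (forall e x y, 0 < e -> mdist x y <= Lambda e -> phi x y <= e).

Definition G_modulus {R : realType} (G alpha : R -> R) :=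
  forall e a, 0 < e -> 0 <= a -> a <= alpha e -> G a <= e.

Definition H_modulus {R : realType} (H beta : R -> R) :=
  forall e a, 0 < e -> 0 <= a -> H a <= beta e -> a <= e.

Definition rate_of_divergence (f kappa : nat -> nat) :=
  forall L n, (kappa L <= n)%N -> (L <= f n)%N.

Definition series_cauchy_rate {R : realType} (eps : nat -> R) (xi : R -> nat) :=
  forall e, 0 < e -> (\sum_(xi e <= i <oo) (eps i)%:E <= e%:E)%E.

Definition zer {R : realType} {X : Type} (F : X -> \bar R) : set X :=
  [set x | F x = 0%E].

Definition dist_to {R : realType} {X : metricType R} (x : X) (Z : set X) : R :=
  inf [set mdist x y | y in Z].

Definition modulus_of_regularity {R : realType} {X : metricType R}
    (F : X -> \bar R) (S : set X) (rho : R -> R) :=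
  forall e x, 0 < e -> S x ->
    (`|F x| < (rho e)%:E)%E -> dist_to x (zer F) < e.

Definition partially_quasi_Fejer_monotone {R : realType} {X : Type}
    (phi_ : nat -> X -> X -> R) (G H : R -> R) (Z : set X)
    (f : nat -> nat) (eps : nat -> R) (x : nat -> X) :=
  forall (n m : nat) (p : X), Z p ->
    H (phi_ (2 * (n + m))%N p (x (2 * (n + m))%N)) <=
      G (phi_ (2 * n)%N p (x (2 * n)%N)) + \sum_(n <= i < n + m) eps i
    /\
    H (phi_ (2 * (n + m)).+1 p (x (2 * (n + m)).+1)) <=
      G (phi_ (2 * f n)%N p (x (2 * f n)%N))
      + \sum_(f n <= i < (n + m).+1) eps i.

Definition cauchy_for {R : realType} {X : Type}
    (psi : X -> X -> R) (x : nat -> X) :=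
  forall e, 0 < e -> exists N : nat,
    forall n m, (N <= n)%N -> (N <= m)%N -> psi (x n) (x m) <= e.

(* The bound is non-strict, as in [cauchy_for] and in the triangularity
   moduli. The strict bound fails for the rate in question: if psi is a
   distance with values 0 and 1 only, its moduli A and theta may be arbitrarily
   large at 1, so nothing excludes psi (x n) (x m) = 1 when d = 1. *)
Definition cauchy_for_with_rate {R : realType} {X : Type}
    (psi : X -> X -> R) (x : nat -> X) (rate : R -> nat) :=
  forall d, 0 < d ->
    forall n m, (rate d <= n)%N -> (rate d <= m)%N -> psi (x n) (x m) <= d.

(* Main.v *)
Require Import Defs.
From mathcomp Require Import lra.

Set Implicit Arguments.
Unset Strict Implicit.
Unset Printing Implicit Defensive.

Import Order.TTheory GRing.Theory Num.Theory.
Import numFieldNormedType.Exports.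

Local Open Scope classical_set_scope.
Local Open Scope ring_scope.

(** Write [b := beta_H (A (theta d)) / 2] and [a := alpha_G b].  The
    approximate zeros supplied by [tau], together with the modulus of
    regularity, yield an index [N] and a true zero [p] of [F] so close to
    [x (2 * f N)] that [phi p (x (2 * f N)) <= a / 2].  Once [f N] has passed
    the rate of uniform convergence, passing from [phi] to [phi_ (2 * f N)]
    costs at most another [a / 2], so [G (phi_ (2 * f N) p (x (2 * f N)))] is
    at most [b] by the choice of [a].

    Quasi-Fejer monotonicity then propagates this single estimate to the whole
    tail ([Fejer_propagation]): both the even and the odd inequality can be
    started at [2 * f N], the even one because [f N <= N] is itself an
    admissible starting index.  Each step is perturbed by a sum of [eps] from
    [f N] on, which is at most [b] as soon as [f N] has passed the Cauchy rate
    of the series.  Hence [H (phi_ n p (x n)) <= b + b = beta_H (A (theta d))]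
    for all [n >= 2 * N], and undoing [H] and then [A] gives
    [psi p (x n) <= theta d].

    So [p] is a common anchor for the tail of the sequence, and triangularity
    of [psi] compares any two terms through it ([anchored_cauchy]).  If
    [phi_ n = phi] and [eps = 0], neither the approximation of [phi] nor the
    perturbation constrains [f N], so [f] need not diverge. *)

Lemma dist_to_lt (R : realType) (X : metricType R) (Z : set X) (y : X) (e : R) :
  Z !=set0 -> dist_to y Z < e -> exists2 p, Z p & mdist y p < e.
Proof.
move=> [z Zz] /inf_lt[|_ [p Zp <-] yp_lt]; last by exists p.
by exists (mdist y z), z.
Qed.

Lemma cauchy_for_mdist (R : realType) (X : metricType R) (x : nat -> X) :
  cauchy_for mdist x -> cauchy (x @ \oo).
Proof.
move=> x_cauchy; apply/cauchy_exP => e e_gt0.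
have [|N xN] := x_cauchy (e / 2); first lra.
exists (x N), N => // n /= Nn; rewrite ballEmdist /=.
by have := xN N n (leqnn N) Nn; lra.
Qed.

Lemma sum_le_cauchy_rate (R : realType) (eps : nat -> R) (xi : R -> nat)
    (e : R) (m n : nat) :
  (forall n, 0 <= eps n) -> series_cauchy_rate eps xi -> 0 < e ->
  (xi e <= m)%N -> \sum_(m <= i < n) eps i <= e.
Proof.
move=> eps_ge0 eps_rate e_gt0 xi_m.
have [nm|/ltnW mn] := leqP n m; first by rewrite big_geq ?ltW.
rewrite -lee_fin; apply: le_trans (eps_rate e e_gt0).
have /(_ n) := @nneseries_lim_ge R (EFin \o eps) xpredT (xi e).
move=> /(_ (fun k _ _ => eps_ge0 k)); apply: le_trans.
rewrite sumEFin lee_fin [leRHS](big_cat_nat xi_m mn) /= lerDr.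
by apply: sumr_ge0 => i _; exact: eps_ge0.
Qed.

(** Regularity places a zero at distance below [Lambda (e / 2)], and
    consistency turns that distance into a bound on [phi]. *)
Lemma zero_near_small_value (R : realType) (X : metricType R)
    (phi : X -> X -> R) (lambda Lambda : R -> R) (F : X -> \bar R) (S : set X)
    (rho : R -> R) (e : R) (y : X) :
  zer F !=set0 -> uniformly_consistent phi lambda Lambda -> pos_map Lambda ->
  modulus_of_regularity F S rho -> 0 < e -> S y ->
  (`|F y| < (rho (Lambda (e / 2)))%:E)%E ->
  exists2 p, zer F p & phi p y <= e.
Proof.
move=> zerF [_ phi_small] Lambda_pos F_reg e_gt0 Sy Fy.
have e2_gt0 : 0 < e / 2 by lra.
have [p Zp yp] := dist_to_lt zerF (F_reg _ _ (Lambda_pos _ e2_gt0) Sy Fy).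
exists p => //; have : phi p y <= e / 2.
  by apply: phi_small => //; rewrite metric_sym ltW.
lra.
Qed.

(** The defining even inequality compares with [x (2 * k)], not with
    [x (2 * f k)]; taking [k := f N] makes both parities start at
    [x (2 * f N)]. *)
Lemma Fejer_propagation (R : realType) (X : Type) (phi_ : nat -> X -> X -> R)
    (G H : R -> R) (Z : set X) (f : nat -> nat) (eps : nat -> R) (x : nat -> X)
    (b c : R) (N n : nat) (p : X) :
  partially_quasi_Fejer_monotone phi_ G H Z f eps x -> Z p -> (f N <= N)%N ->
  G (phi_ (2 * f N)%N p (x (2 * f N)%N)) <= b ->
  (forall k, \sum_(f N <= i < k) eps i <= c) ->
  (2 * N <= n)%N -> H (phi_ n p (x n)) <= b + c.
Proof.
move=> Fejer Zp fN_le Gb sum_c N_le_n.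
have nE : n = (odd n + 2 * n./2)%N by rewrite mul2n odd_double_half.
have N_le : (N <= n./2)%N by rewrite -[N]doubleK -mul2n half_leq.
rewrite nE; case: (odd n) => /=.
- have [_] := Fejer N (n./2 - N)%N p Zp; rewrite subnKC // add1n.
  by move/le_trans; apply; apply: lerD.
- have [+ _] := Fejer (f N) (n./2 - f N)%N p Zp.
  rewrite subnKC ?(leq_trans fN_le) // add0n.
  by move/le_trans; apply; apply: lerD.
Qed.

(** Halving [beta_H (A e)] leaves one half for the starting value and one for
    the accumulated perturbations; then [H] and [A] are undone in turn. *)
Lemma Fejer_anchor (R : realType) (X : Type) (phi_ : nat -> X -> X -> R)
    (psi : X -> X -> R) (A G H alpha_G beta_H : R -> R) (Z : set X)
    (f : nat -> nat) (eps : nat -> R) (x : nat -> X) (e : R) (N n : nat)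
    (p : X) :
  let b := beta_H (A e) / 2 in
  (forall n, nonneg_fun2 (phi_ n)) -> (forall n, dominated_by A psi (phi_ n)) ->
  pos_map A -> pos_map beta_H -> G_modulus G alpha_G -> H_modulus H beta_H ->
  partially_quasi_Fejer_monotone phi_ G H Z f eps x -> Z p -> (f N <= N)%N ->
  0 < e -> phi_ (2 * f N)%N p (x (2 * f N)%N) <= alpha_G b ->
  (forall k, \sum_(f N <= i < k) eps i <= b) ->
  (2 * N <= n)%N -> psi p (x n) <= e.
Proof.
move=> b phi_ge0 psi_dom A_pos beta_pos G_mod H_mod Fejer Zp fN_le e_gt0.
move=> phi_small sum_b N_le_n.
have Ae_gt0 := A_pos _ e_gt0.
have b_gt0 : 0 < b by rewrite divr_gt0 // beta_pos.
have Gb := G_mod _ _ b_gt0 (phi_ge0 _ _ _) phi_small.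
apply: (psi_dom n _ _ _ e_gt0); apply: (H_mod _ _ Ae_gt0 (phi_ge0 n _ _)).
rewrite [leRHS]splitr.
exact: (Fejer_propagation Fejer Zp fN_le Gb sum_b N_le_n).
Qed.

(** Common to both kinds of triangularity, with [D] either [psi] or the
    distance. *)
Lemma anchored_cauchy_for (R : realType) (X : Type) (psi D : X -> X -> R)
    (theta : R -> R) (x : nat -> X) (rate : R -> nat) :
  (forall e u y z, 0 < e ->
    psi y u <= theta e -> psi y z <= theta e -> D u z <= e) ->
  (forall e, 0 < e ->
    exists p, forall n, (rate e <= n)%N -> psi p (x n) <= theta e) ->
  cauchy_for D x /\ cauchy_for_with_rate D x rate.
Proof.
move=> tri anchor.
have x_rate : cauchy_for_with_rate D x rate.
  move=> e e_gt0 n m n_ge m_ge; have [p px] := anchor e e_gt0.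
  by apply: (tri e _ p) => //; exact: px.
by split=> // e /x_rate xe; exists (rate e).
Qed.

Lemma anchored_cauchy (R : realType) (X : metricType R) (psi : X -> X -> R)
    (theta : R -> R) (x : nat -> X) (rate : R -> nat) :
  (forall e, 0 < e ->
    exists p, forall n, (rate e <= n)%N -> psi p (x n) <= theta e) ->
  (uniformly_weakly_triangular psi theta ->
    cauchy_for psi x /\ cauchy_for_with_rate psi x rate) /\
  (uniformly_triangular psi theta ->
    cauchy (x @ \oo) /\ cauchy_for_with_rate mdist x rate).
Proof.
move=> anchor; split=> tri; first exact: anchored_cauchy_for tri anchor.
have [x_cauchy x_rate] := anchored_cauchy_for tri anchor.
by split=> //; exact: cauchy_for_mdist.
Qed.

Theorem theorem6p8 (R : realType) (X : metricType R)
  (phi_ : nat -> X -> X -> R) (phi psi : X -> X -> R)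
  (A theta lambda Lambda : R -> R) (pi_rate : R -> nat)
  (F : X -> \bar R) (f : nat -> nat) (x : nat -> X)
  (G H alpha_G beta_H : R -> R) (eps : nat -> R) (xi : R -> nat)
  (S : set X) (rho : R -> R)
  (phi_ge0 : forall n, nonneg_fun2 (phi_ n))
  (philim_ge0 : nonneg_fun2 phi)
  (psi_ge0 : nonneg_fun2 psi)
  (A_pos : pos_map A) (theta_pos : pos_map theta)
  (lambda_pos : pos_map lambda) (Lambda_pos : pos_map Lambda)
  (G_ge0 : nonneg_map G) (H_ge0 : nonneg_map H)
  (alpha_pos : pos_map alpha_G) (beta_pos : pos_map beta_H)
  (rho_pos : pos_map rho)
  (eps_ge0 : forall n, 0 <= eps n)
  (eps_sum : (\sum_(0 <= i <oo) (eps i)%:E < +oo)%E)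
  (psi_dom : forall n, dominated_by A psi (phi_ n))
  (phi_incr : increases_uniformly_to phi_ phi pi_rate)
  (phi_cons : uniformly_consistent phi lambda Lambda)
  (zerF : zer F !=set0)
  (f_mono : forall m n, (m <= n)%N -> (f m <= f n)%N)
  (f_le : forall n, (f n <= n)%N)
  (Fejer : partially_quasi_Fejer_monotone phi_ G H (zer F) f eps x)
  (G_mod : G_modulus G alpha_G) (H_mod : H_modulus H beta_H)
  (xS : forall n, S (x n))
  (F_reg : modulus_of_regularity F S rho)
  (eps_rate : series_cauchy_rate eps xi) :
  let rho' e := rho (Lambda (e / 2)) in
  let beta d := beta_H (A (theta d)) / 2 in
  (forall (kappa : nat -> nat) (tau : R -> nat -> nat),
    rate_of_divergence f kappa ->
    (forall d n, 0 < d ->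
      exists N : nat, (n <= N <= tau d n)%N /\
                      (`|F (x (2 * f N)%N)| < d%:E)%E) ->
    let mu' d := tau (rho' (alpha_G (beta d) / 2))
                     (maxn (kappa (xi (beta d)))
                           (kappa (pi_rate (alpha_G (beta d) / 2)))) in
    (uniformly_weakly_triangular psi theta ->
      cauchy_for psi x /\
      cauchy_for_with_rate psi x (fun d => 2 * mu' d)%N) /\
    (uniformly_triangular psi theta ->
      cauchy (x @ \oo) /\
      cauchy_for_with_rate mdist x (fun d => 2 * mu' d)%N))
  /\
  ((forall n, phi_ n = phi) -> (forall n, eps n = 0) ->
   forall tau : R -> nat,
    (forall d, 0 < d ->
      exists N : nat, (N <= tau d)%N /\ (`|F (x (2 * f N)%N)| < d%:E)%E) ->
    let mu' d := tau (rho' (alpha_G (beta d) / 2)) in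
    (uniformly_weakly_triangular psi theta ->
      cauchy_for psi x /\
      cauchy_for_with_rate psi x (fun d => 2 * mu' d)%N) /\
    (uniformly_triangular psi theta ->
      cauchy (x @ \oo) /\
      cauchy_for_with_rate mdist x (fun d => 2 * mu' d)%N)).
Proof.
move=> rho' beta.
have beta_gt0 d : 0 < d -> 0 < beta d.
  by move=> d_gt0; rewrite divr_gt0 // beta_pos // A_pos // theta_pos.
have a_gt0 d : 0 < d -> 0 < alpha_G (beta d) / 2.
  by move=> d_gt0; rewrite divr_gt0 // alpha_pos // beta_gt0.
have rho'_gt0 d : 0 < d -> 0 < rho' (alpha_G (beta d) / 2).
  by move=> /a_gt0 ?; apply/rho_pos/Lambda_pos; rewrite divr_gt0.
have near_zero := zero_near_small_value zerF phi_cons Lambda_pos F_reg _ (xS _).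
have anchor d N p : 0 < d -> zer F p ->
    phi_ (2 * f N)%N p (x (2 * f N)%N) <= alpha_G (beta d) ->
    (forall k, \sum_(f N <= i < k) eps i <= beta d) ->
    forall n, (2 * N <= n)%N -> psi p (x n) <= theta d.
  move=> /theta_pos d_gt0 Zp phi_small sum_b n.
  exact: (Fejer_anchor phi_ge0 psi_dom A_pos beta_pos G_mod H_mod Fejer).
split.
- move=> kappa tau f_div tauP mu'; apply: anchored_cauchy => d d_gt0.
  have [N [/andP[+ N_le] FN]] :=
    tauP _ (maxn (kappa (xi (beta d)))
                 (kappa (pi_rate (alpha_G (beta d) / 2)))) (rho'_gt0 d d_gt0).
  rewrite geq_max => /andP[/f_div xi_fN /f_div pi_fN].
  have [p Zp phi_p] := near_zero _ _ (a_gt0 d d_gt0) FN.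
  exists p => n n_ge; apply: (anchor d N) => //.
  + have pi_2fN : (pi_rate (alpha_G (beta d) / 2)%R <= 2 * f N)%N.
      by rewrite (leq_trans pi_fN) // leq_pmull.
    have := phi_incr _ _ p (x (2 * f N)%N) (a_gt0 d d_gt0) pi_2fN; lra.
  + by move=> k; apply: sum_le_cauchy_rate xi_fN; rewrite ?beta_gt0.
  + by rewrite (leq_trans _ n_ge) // leq_mul2l.
- move=> phiE eps0 tau tauP mu'; apply: anchored_cauchy => d d_gt0.
  have [N [N_le FN]] := tauP _ (rho'_gt0 d d_gt0).
  have [p Zp phi_p] := near_zero _ _ (a_gt0 d d_gt0) FN.
  exists p => n n_ge; apply: (anchor d N) => //.
  + by rewrite phiE; have := a_gt0 d d_gt0; lra.
  + by move=> k; rewrite big1 ?ltW ?beta_gt0.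
  + by rewrite (leq_trans _ n_ge) // leq_mul2l.
Qed.
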